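(* Let $\mathcal C$ be a monoidal category, regarded as a skew monoidal category whose structure maps $a,\ell,r$ are invertible. Then braidings (respectively symmetries) on $\mathcal C$ as a skew monoidal category are in bijection with braidings (respectively symmetries) on the monoidal category $\mathcal C$ in the usual sense.
   Context: A skew monoidal category is a category with a functor $(X,Y)\mapsto XY$, an object $I$ and natural transformations (not necessarily invertible) $a_{X,Y,Z}\colon (XY)Z\to X(YZ)$, $\ell_X\colon IX\to X$, $r_X\colon X\to XI$ such that $a_{A,B,CD}\,a_{AB,C,D}=(1_A a_{B,C,D})\,a_{A,BC,D}\,(a_{A,B,C}1_D)$; $\ell_{AB}\,a_{I,A,B}=\ell_A1_B$; $(1_A\ell_B)\,a_{A,I,B}\,(r_A1_B)=1_{AB}$; $a_{A,B,I}\,r_{AB}=1_Ar_B$; $\ell_I r_I=1_I$. When $a,\ell,r$ are invertible this is a monoidal category. A braiding on a skew monoidal category is a natural isomorphism $s_{X,A,B}\colon (XA)B\to (XB)A$ such that for all objects: (B1) $s_{XC,A,B}(s_{X,A,C}1_B)s_{XA,B,C}=(s_{X,B,C}1_A)s_{XB,A,C}(s_{X,A,B}1_C)$; (B2) $s_{X,A,BC}\,a_{XA,B,C}=(a_{X,B,C}1_A)s_{XB,A,C}(s_{X,A,B}1_C)$; (B3) $s_{X,AB,C}(a_{X,A,B}1_C)=a_{XC,A,B}(s_{X,A,C}1_B)s_{XA,B,C}$; (B4) $(1_Xs_{A,B,C})\,a_{X,AB,C}(a_{X,A,B}1_C)=a_{X,AC,B}(a_{X,A,C}1_B)s_{XA,B,C}$.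 It is a symmetry if moreover $s_{X,B,A}s_{X,A,B}=1$. *)

(* Defs.v *)
From mathcomp Require Import ssreflect ssrfun.

Set Implicit Arguments.
Unset Strict Implicit.
Unset Printing Implicit Defensive.

Declare Scope cat_scope.
Delimit Scope cat_scope with cat.
Local Open Scope cat_scope.

Reserved Notation "g ∘ f" (at level 40, left associativity).
Reserved Notation "X ⊗ Y" (at level 30, right associativity).
Reserved Notation "f ⊠ g" (at level 30, right associativity).

(* Composition is written in the classical order: [comp g f] is "g after f". *)
Record category := Category {
  obj :> Type;
  hom : obj -> obj -> Type;
  ident : forall X, hom X X;
  comp : forall X Y Z, hom Y Z -> hom X Y -> hom X Z;
  comp_id_l : forall X Y (f : hom X Y), comp (ident Y) f = f;
  comp_id_r : forall X Y (f : hom X Y), comp f (ident X) = f;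
  comp_assoc : forall W X Y Z (h : hom Y Z) (g : hom X Y) (f : hom W X),
    comp h (comp g f) = comp (comp h g) f
}.

Arguments hom {c} X Y.
Arguments ident {c} X.
Arguments comp {c X Y Z} g f.

Notation "g ∘ f" := (comp g f) : cat_scope.
Notation "\1" := (ident _) : cat_scope.

Definition mutually_inverse (C : category) (X Y : C) (f : hom X Y)
    (g : hom Y X) : Prop :=
  g ∘ f = \1 /\ f ∘ g = \1.

Definition is_iso (C : category) (X Y : C) (f : hom X Y) : Prop :=
  exists g : hom Y X, mutually_inverse f g.

Section ProductCategory.
Variables C D : category.

Let pobj : Type := (C * D)%type.
Let phom (X Y : pobj) : Type := (hom X.1 Y.1 * hom X.2 Y.2)%type.
Let pident (X : pobj) : phom X X := (\1, \1).
Let pcomp (X Y Z : pobj) (g : phom Y Z) (f : phom X Y) : phom X Z :=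
  (g.1 ∘ f.1, g.2 ∘ f.2).

Fact prod_comp_id_l X Y (f : phom X Y) : pcomp (pident Y) f = f.
Proof. by case: f => f1 f2; rewrite /pcomp !comp_id_l. Qed.

Fact prod_comp_id_r X Y (f : phom X Y) : pcomp f (pident X) = f.
Proof. by case: f => f1 f2; rewrite /pcomp !comp_id_r. Qed.

Fact prod_comp_assoc W X Y Z (h : phom Y Z) (g : phom X Y) (f : phom W X) :
  pcomp h (pcomp g f) = pcomp (pcomp h g) f.
Proof. by rewrite /pcomp !comp_assoc. Qed.

Definition prod_category : category :=
  Category prod_comp_id_l prod_comp_id_r prod_comp_assoc.

End ProductCategory.

Record functor (C D : category) := Functor {
  fobj :> C -> D;
  fmap : forall X Y : C, hom X Y -> hom (fobj X) (fobj Y);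
  fmap_id : forall X : C, fmap (ident X) = \1;
  fmap_comp : forall (X Y Z : C) (g : hom Y Z) (f : hom X Y),
    fmap (g ∘ f) = fmap g ∘ fmap f
}.

(* The structure carried by a skew monoidal category before the constraints
   a, l, r are added: the tensor functor and the unit object. *)
Record tensor_category := TensorCategory {
  tensor_base :> category;
  tensor : functor (prod_category tensor_base tensor_base) tensor_base;
  unit_obj : tensor_base
}.

Arguments unit_obj {t}.

Definition tens (C : tensor_category) (X Y : C) : C := tensor C (X, Y).

Definition tens_hom (C : tensor_category) (X X' Y Y' : C)
    (f : hom X X') (g : hom Y Y') : hom (tens X Y) (tens X' Y') :=
  @fmap _ _ (tensor C) (X, Y) (X', Y') (f, g).

Notation "X ⊗ Y" := (tens X Y) : cat_scope.
Notation "f ⊠ g" := (tens_hom f g) : cat_scope.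
Notation "'𝟙'" := unit_obj : cat_scope.

Record skew_monoidal_category := SkewMonoidalCategory {
  skew_base :> tensor_category;
  assoc : forall X Y Z : skew_base, hom ((X ⊗ Y) ⊗ Z) (X ⊗ (Y ⊗ Z));
  lunit : forall X : skew_base, hom (𝟙 ⊗ X) X;
  runit : forall X : skew_base, hom X (X ⊗ 𝟙);
  assoc_natural : forall (X X' Y Y' Z Z' : skew_base)
      (f : hom X X') (g : hom Y Y') (h : hom Z Z'),
    assoc X' Y' Z' ∘ ((f ⊠ g) ⊠ h) = (f ⊠ (g ⊠ h)) ∘ assoc X Y Z;
  lunit_natural : forall (X X' : skew_base) (f : hom X X'),
    lunit X' ∘ (ident 𝟙 ⊠ f) = f ∘ lunit X;
  runit_natural : forall (X X' : skew_base) (f : hom X X'),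
    runit X' ∘ f = (f ⊠ ident 𝟙) ∘ runit X;
  skew_pentagon : forall A B C D : skew_base,
    assoc A B (C ⊗ D) ∘ assoc (A ⊗ B) C D
    = (ident A ⊠ assoc B C D) ∘ assoc A (B ⊗ C) D ∘ (assoc A B C ⊠ ident D);
  skew_lunit_assoc : forall A B : skew_base,
    lunit (A ⊗ B) ∘ assoc 𝟙 A B = lunit A ⊠ ident B;
  skew_triangle : forall A B : skew_base,
    (ident A ⊠ lunit B) ∘ assoc A 𝟙 B ∘ (runit A ⊠ ident B) = ident (A ⊗ B);
  skew_assoc_runit : forall A B : skew_base,
    assoc A B 𝟙 ∘ runit (A ⊗ B) = ident A ⊠ runit B;
  skew_lunit_runit : lunit 𝟙 ∘ runit 𝟙 = ident (unit_obj : skew_base)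
}.

Arguments assoc {s} X Y Z.
Arguments lunit {s} X.
Arguments runit {s} X.

Record monoidal_category := MonoidalCategory {
  monoidal_skew :> skew_monoidal_category;
  assoc_inv : forall X Y Z : monoidal_skew,
    hom (X ⊗ (Y ⊗ Z)) ((X ⊗ Y) ⊗ Z);
  lunit_inv : forall X : monoidal_skew, hom X (𝟙 ⊗ X);
  runit_inv : forall X : monoidal_skew, hom (X ⊗ 𝟙) X;
  assoc_invP : forall X Y Z : monoidal_skew,
    mutually_inverse (assoc X Y Z) (assoc_inv X Y Z);
  lunit_invP : forall X : monoidal_skew,
    mutually_inverse (lunit X) (lunit_inv X);
  runit_invP : forall X : monoidal_skew,
    mutually_inverse (runit X) (runit_inv X)
}.

Arguments assoc_inv {m} X Y Z.
Arguments lunit_inv {m} X.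
Arguments runit_inv {m} X.

Record skew_braiding (C : skew_monoidal_category) := SkewBraiding {
  sbraid :> forall X A B : C, hom ((X ⊗ A) ⊗ B) ((X ⊗ B) ⊗ A);
  sbraid_natural : forall (X X' A A' B B' : C)
      (f : hom X X') (g : hom A A') (h : hom B B'),
    sbraid X' A' B' ∘ ((f ⊠ g) ⊠ h) = ((f ⊠ h) ⊠ g) ∘ sbraid X A B;
  sbraid_iso : forall X A B : C, is_iso (sbraid X A B);
  sbraid_B1 : forall X A B D : C,
    sbraid (X ⊗ D) A B ∘ (sbraid X A D ⊠ ident B) ∘ sbraid (X ⊗ A) B D
    = (sbraid X B D ⊠ ident A) ∘ sbraid (X ⊗ B) A D
      ∘ (sbraid X A B ⊠ ident D);
  sbraid_B2 : forall X A B D : C,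
    sbraid X A (B ⊗ D) ∘ assoc (X ⊗ A) B D
    = (assoc X B D ⊠ ident A) ∘ sbraid (X ⊗ B) A D
      ∘ (sbraid X A B ⊠ ident D);
  sbraid_B3 : forall X A B D : C,
    sbraid X (A ⊗ B) D ∘ (assoc X A B ⊠ ident D)
    = assoc (X ⊗ D) A B ∘ (sbraid X A D ⊠ ident B) ∘ sbraid (X ⊗ A) B D;
  sbraid_B4 : forall X A B D : C,
    (ident X ⊠ sbraid A B D) ∘ assoc X (A ⊗ B) D ∘ (assoc X A B ⊠ ident D)
    = assoc X (A ⊗ D) B ∘ (assoc X A D ⊠ ident B) ∘ sbraid (X ⊗ A) B D
}.

Record skew_symmetry (C : skew_monoidal_category) := SkewSymmetry {
  skew_symmetry_braiding :> skew_braiding C;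
  skew_symmetry_invol : forall X A B : C,
    skew_symmetry_braiding X B A ∘ skew_symmetry_braiding X A B = \1
}.

(* Braidings on a monoidal category in the sense of Joyal and Street: natural
   isomorphisms A ⊗ B -> B ⊗ A satisfying the two hexagon identities. *)
Record braiding (C : monoidal_category) := Braiding {
  braid :> forall A B : C, hom (A ⊗ B) (B ⊗ A);
  braid_natural : forall (A A' B B' : C) (f : hom A A') (g : hom B B'),
    braid A' B' ∘ (f ⊠ g) = (g ⊠ f) ∘ braid A B;
  braid_iso : forall A B : C, is_iso (braid A B);
  braid_hexagon1 : forall A B D : C,
    assoc B D A ∘ braid A (B ⊗ D) ∘ assoc A B D
    = (ident B ⊠ braid A D) ∘ assoc B A D ∘ (braid A B ⊠ ident D);
  braid_hexagon2 : forall A B D : C,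
    assoc_inv D A B ∘ braid (A ⊗ B) D ∘ assoc_inv A B D
    = (braid A D ⊠ ident B) ∘ assoc_inv A D B ∘ (ident A ⊠ braid B D)
}.

Record symmetry (C : monoidal_category) := Symmetry {
  symmetry_braiding :> braiding C;
  symmetry_invol : forall A B : C,
    symmetry_braiding B A ∘ symmetry_braiding A B = \1
}.

(* Main.v *)
(** The two notions correspond through [a s = (1 c) a]: conjugating by the
    associativity expresses [s] by [c], and [c] is recovered from [s] at
    [X = I] by conjugating with the left unit constraint; that the latter
    [c] satisfies the relation for every [X] is (B4) with middle object [I].
    Under this relation (B4) holds automatically, (B2) and (B3) at [X] are the
    two hexagons tensored on the left with [X], hence equivalent to the
    hexagons since tensoring with [I] is faithful, and (B1) is the Yang-Baxter
    equation, which follows from (B2) and naturality. *)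

Require Import Defs.
From mathcomp Require Import ssreflect ssrfun ssrbool.
From Stdlib Require Import FunctionalExtensionality ProofIrrelevance.
Set Implicit Arguments.
Unset Strict Implicit.
Unset Printing Implicit Defensive.

Local Open Scope cat_scope.

(** * Cancelling isomorphisms, and functoriality of the tensor *)

Lemma comp_reassoc (C : category) (X Y Z : C) (f : hom X Y) (g : hom Y Z)
    (h : hom X Z) :
  g ∘ f = h -> forall W (k : hom W X), g ∘ (f ∘ k) = h ∘ k.
Proof. by move=> <- W k; rewrite comp_assoc. Qed.

Lemma iso_monic (C : category) (X Y Z : C) (f : hom Y Z) (g h : hom X Y) :
  is_iso f -> f ∘ g = f ∘ h -> g = h.
Proof.
move=> [f' [f'f _]] fgh.
by rewrite -(comp_id_l g) -(comp_id_l h) -f'f -!comp_assoc fgh.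
Qed.

Lemma iso_epic (C : category) (X Y Z : C) (f : hom X Y) (g h : hom Y Z) :
  is_iso f -> g ∘ f = h ∘ f -> g = h.
Proof.
move=> [f' [_ ff']] fgh.
by rewrite -(comp_id_r g) -(comp_id_r h) -ff' !comp_assoc fgh.
Qed.

Lemma iso_comp (C : category) (X Y Z : C) (g : hom Y Z) (f : hom X Y) :
  is_iso g -> is_iso f -> is_iso (g ∘ f).
Proof.
move=> [g' [g'g gg']] [f' [f'f ff']]; exists (f' ∘ g'); split.
  by rewrite -comp_assoc (comp_reassoc g'g) comp_id_l.
by rewrite -comp_assoc (comp_reassoc ff') comp_id_l.
Qed.

Lemma iso_ident (C : category) (X : C) : is_iso (ident X).
Proof. by exists \1; split; rewrite comp_id_l. Qed.

Lemma tens_id (C : tensor_category) (X Y : C) :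
  ident X ⊠ ident Y = ident (X ⊗ Y).
Proof. exact: (fmap_id (tensor C) (X, Y)). Qed.

Lemma tens_comp (C : tensor_category) (X X' X'' Y Y' Y'' : C)
    (f' : hom X' X'') (f : hom X X') (g' : hom Y' Y'') (g : hom Y Y') :
  (f' ∘ f) ⊠ (g' ∘ g) = (f' ⊠ g') ∘ (f ⊠ g).
Proof.
exact: (@fmap_comp _ _ (tensor C) (X, Y) (X', Y') (X'', Y'') (f', g') (f, g)).
Qed.

Lemma tens_comp_l (C : tensor_category) (X Y Y' Y'' : C)
    (g' : hom Y' Y'') (g : hom Y Y') :
  ident X ⊠ (g' ∘ g) = (ident X ⊠ g') ∘ (ident X ⊠ g).
Proof. by rewrite -tens_comp comp_id_l. Qed.

Lemma tens_comp_r (C : tensor_category) (X Y Y' Y'' : C)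
    (g' : hom Y' Y'') (g : hom Y Y') :
  (g' ∘ g) ⊠ ident X = (g' ⊠ ident X) ∘ (g ⊠ ident X).
Proof. by rewrite -tens_comp comp_id_l. Qed.

Lemma iso_tens (C : tensor_category) (X X' Y Y' : C)
    (f : hom X X') (g : hom Y Y') :
  is_iso f -> is_iso g -> is_iso (f ⊠ g).
Proof.
move=> [f' [f'f ff']] [g' [g'g gg']]; exists (f' ⊠ g').
by split; rewrite -tens_comp ?f'f ?g'g ?ff' ?gg' tens_id.
Qed.

(** * Consequences of invertible constraints *)

Lemma iso_assoc (C : monoidal_category) (X Y Z : C) : is_iso (assoc X Y Z).
Proof. by exists (assoc_inv X Y Z); apply: assoc_invP. Qed.

Lemma iso_assoc_inv (C : monoidal_category) (X Y Z : C) :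
  is_iso (assoc_inv X Y Z).
Proof. by exists (assoc X Y Z); case: (assoc_invP X Y Z). Qed.

Lemma iso_lunit (C : monoidal_category) (X : C) : is_iso (lunit X).
Proof. by exists (lunit_inv X); apply: lunit_invP. Qed.

Lemma iso_lunit_inv (C : monoidal_category) (X : C) : is_iso (lunit_inv X).
Proof. by exists (lunit X); case: (lunit_invP X). Qed.

Lemma assoc_invK (C : monoidal_category) (X Y Z : C) :
  assoc_inv X Y Z ∘ assoc X Y Z = \1.
Proof. by case: (assoc_invP X Y Z). Qed.

Lemma assocK (C : monoidal_category) (X Y Z : C) :
  assoc X Y Z ∘ assoc_inv X Y Z = \1.
Proof. by case: (assoc_invP X Y Z). Qed.

Lemma lunit_inv_natural (C : monoidal_category) (X X' : C) (f : hom X X') :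
  lunit_inv X' ∘ f = (ident 𝟙 ⊠ f) ∘ lunit_inv X.
Proof.
apply: (iso_monic (iso_lunit X')); apply: (iso_epic (iso_lunit X)).
rewrite -!comp_assoc (comp_reassoc (lunit_natural f)).
by case: (lunit_invP X) => -> _; case: (lunit_invP X') => _ /comp_reassoc ->;
  rewrite comp_id_l comp_id_r.
Qed.

Lemma unit_tens_inj (C : monoidal_category) (X Y : C) (f g : hom X Y) :
  ident 𝟙 ⊠ f = ident 𝟙 ⊠ g -> f = g.
Proof.
by move=> fg; apply: (iso_epic (iso_lunit X)); rewrite -!lunit_natural fg.
Qed.

(** Inverting [runit] carries it to the other side of the skew triangle axiom. *)
Lemma triangle (C : monoidal_category) (X Y : C) :
  (ident X ⊠ lunit Y) ∘ assoc X 𝟙 Y = runit_inv X ⊠ ident Y.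
Proof.
case: (runit_invP X) => r'r rr'.
have ir : is_iso (runit X ⊠ ident Y).
  by apply: iso_tens (iso_ident Y); exists (runit_inv X).
by apply: (iso_epic ir); rewrite skew_triangle -tens_comp_r r'r tens_id.
Qed.

(** Stated for bare families, so that each axiom can be transported before either family is known to
    be a braiding. *)
Definition corresponds (C : skew_monoidal_category)
    (s : forall X A B : C, hom ((X ⊗ A) ⊗ B) ((X ⊗ B) ⊗ A))
    (c : forall A B : C, hom (A ⊗ B) (B ⊗ A)) : Prop :=
  forall X A B,
    assoc X B A ∘ s X A B = (ident X ⊠ c A B) ∘ assoc X A B.

(** * Transport of the axioms along the relation *)

Section Correspondence.
Context (C : monoidal_category).
Context (s : forall X A B : C, hom ((X ⊗ A) ⊗ B) ((X ⊗ B) ⊗ A)).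
Context (c : forall A B : C, hom (A ⊗ B) (B ⊗ A)).
Context (sc : corresponds s c).

(** Take [X = 𝟙] in the relation and strip the factor [𝟙] by naturality of [lunit]. Hence [s]
    determines [c]. *)
Lemma corresponds_left : forall A B,
  c A B = lunit (B ⊗ A) ∘ (assoc 𝟙 B A ∘ s 𝟙 A B ∘ assoc_inv 𝟙 A B)
          ∘ lunit_inv (A ⊗ B).
Proof.
move=> A B; rewrite sc -!comp_assoc (comp_reassoc (assocK _ _ _)) comp_id_l.
rewrite (comp_reassoc (lunit_natural _)) -comp_assoc.
by case: (lunit_invP (A ⊗ B)) => _ ->; rewrite comp_id_r.
Qed.

Lemma corresponds_right X A B :
  s X A B = assoc_inv X B A ∘ (ident X ⊠ c A B) ∘ assoc X A B.
Proof. by rewrite -comp_assoc -sc comp_assoc assoc_invK comp_id_l. Qed.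

Lemma B2_hexagon1 X A B D :
  s X A (B ⊗ D) ∘ assoc (X ⊗ A) B D
    = (assoc X B D ⊠ ident A) ∘ s (X ⊗ B) A D ∘ (s X A B ⊠ ident D)
  <-> ident X ⊠ (assoc B D A ∘ c A (B ⊗ D) ∘ assoc A B D)
    = ident X ⊠ ((ident B ⊠ c A D) ∘ assoc B A D ∘ (c A B ⊠ ident D)).
Proof.
set u := (u in u = _ <-> _); set v := (v in _ = v <-> _).
set L := (L in _ <-> _ ⊠ L = _); set R := (R in _ <-> _ = _ ⊠ R).
(* [M] and [N] rebracket the target and source of (B2) so that [X] stands alone on the left; being
   invertible, they carry (B2) to the tensored hexagon and back. *)
pose M := (ident X ⊠ assoc B D A) ∘ assoc X (B ⊗ D) A.
pose N := assoc X (A ⊗ B) D ∘ (assoc X A B ⊠ ident D).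
have Mu : M ∘ u = (ident X ⊠ L) ∘ N.
  rewrite /M /u /L /N -!comp_assoc (comp_reassoc (sc _ _ _)) !tens_comp_l.
  by rewrite -!comp_assoc skew_pentagon -!comp_assoc.
(* Each of the two factors [s] is turned into a [c] by the relation, with a pentagon before each use
   to expose the required associativity. *)
have Mv : M ∘ v = (ident X ⊠ R) ∘ N.
  rewrite /M /v /R /N comp_assoc comp_assoc -skew_pentagon -!comp_assoc.
  rewrite (comp_reassoc (sc _ _ _)) -tens_id -!comp_assoc.
  rewrite (comp_reassoc (assoc_natural _ _ _)) -!comp_assoc.
  rewrite (comp_reassoc (skew_pentagon _ _ _ _)) -!comp_assoc -tens_comp_r sc.
  rewrite tens_comp_r (comp_reassoc (assoc_natural _ _ _)) !tens_comp_l.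
  by rewrite -!comp_assoc.
have iM : is_iso M.
  apply: iso_comp (iso_assoc _ _ _).
  by apply: iso_tens (iso_ident _) (iso_assoc _ _ _).
have iN : is_iso N.
  apply: iso_comp (iso_assoc _ _ _) _.
  by apply: iso_tens (iso_assoc _ _ _) (iso_ident _).
split=> [uv|LR]; first by apply: (iso_epic iN); rewrite -Mu -Mv uv.
by apply: (iso_monic iM); rewrite Mu Mv LR.
Qed.

Lemma B3_hexagon2 X A B D :
  s X (A ⊗ B) D ∘ (assoc X A B ⊠ ident D)
    = assoc (X ⊗ D) A B ∘ (s X A D ⊠ ident B) ∘ s (X ⊗ A) B D
  <-> ident X ⊠ (assoc_inv D A B ∘ c (A ⊗ B) D ∘ assoc_inv A B D)
    = ident X ⊠ ((c A D ⊠ ident B) ∘ assoc_inv A D B ∘ (ident A ⊠ c B D)).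
Proof.
set u := (u in u = _ <-> _); set v := (v in _ = v <-> _).
set L := (L in _ <-> _ ⊠ L = _); set R := (R in _ <-> _ = _ ⊠ R).
pose M := (ident X ⊠ assoc_inv D A B) ∘ assoc X D (A ⊗ B).
(* The extra factor [assoc A B D] cancels the rightmost [assoc_inv A B D] of the second hexagon. *)
pose N := (ident X ⊠ assoc A B D) ∘ assoc X (A ⊗ B) D
          ∘ (assoc X A B ⊠ ident D).
have pent' (E F G : C) :
    (ident X ⊠ assoc_inv E F G) ∘ (assoc X E (F ⊗ G) ∘ assoc (X ⊗ E) F G)
    = assoc X (E ⊗ F) G ∘ (assoc X E F ⊠ ident G).
  rewrite skew_pentagon -comp_assoc comp_assoc -tens_comp_l assoc_invK tens_id.
  by rewrite comp_id_l.
have Mu : M ∘ u = (ident X ⊠ L) ∘ N.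
  rewrite /M /u /L /N !tens_comp_l -!comp_assoc.
  rewrite (comp_reassoc (esym (tens_comp_l X (assoc_inv A B D) _))).
  by rewrite assoc_invK tens_id comp_id_l (comp_reassoc (sc _ _ _)) -!comp_assoc.
have Mv : M ∘ v = (ident X ⊠ R) ∘ N.
  rewrite /N -skew_pentagon /M /v /R -!comp_assoc.
  rewrite [in LHS](comp_assoc (assoc _ _ _)) (comp_reassoc (pent' _ _ _)).
  rewrite -!comp_assoc (comp_reassoc (esym (tens_comp_r _ _ _))) sc.
  rewrite tens_comp_r -!comp_assoc (comp_reassoc (assoc_natural _ _ _)).
  rewrite -!comp_assoc (comp_assoc _ (assoc _ _ _ ⊠ _)) -pent' -!comp_assoc sc.
  rewrite -tens_id (comp_reassoc (assoc_natural _ _ _)) !tens_comp_l.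
  by rewrite -!comp_assoc.
have iM : is_iso M.
  apply: iso_comp (iso_assoc _ _ _).
  by apply: iso_tens (iso_ident _) (iso_assoc_inv _ _ _).
have iN : is_iso N.
  rewrite /N -skew_pentagon.
  by apply: iso_comp (iso_assoc _ _ _) (iso_assoc _ _ _).
split=> [uv|LR]; first by apply: (iso_epic iN); rewrite -Mu -Mv uv.
by apply: (iso_monic iM); rewrite Mu Mv LR.
Qed.

(** After composing with [ident X ⊠ assoc A D B], both sides become [ident X ⊠ (ident A ⊠ c B D)]
    after a side of the pentagon, by the relation and naturality of [assoc] alone. *)
Lemma corresponds_B4 X A B D :
  (ident X ⊠ s A B D) ∘ assoc X (A ⊗ B) D ∘ (assoc X A B ⊠ ident D)
  = assoc X (A ⊗ D) B ∘ (assoc X A D ⊠ ident B) ∘ s (X ⊗ A) B D.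
Proof.
have ia : is_iso (ident X ⊠ assoc A D B).
  by apply: iso_tens (iso_ident _) (iso_assoc _ _ _).
apply: (iso_monic ia); rewrite !comp_assoc -tens_comp_l sc tens_comp_l.
rewrite -skew_pentagon -!comp_assoc sc -tens_id.
rewrite (comp_reassoc (assoc_natural _ _ _)) -!comp_assoc skew_pentagon.
by rewrite -!comp_assoc.
Qed.

(** Naturality in the additional variable [X] comes from that of [assoc]; the converse takes the
    identity of [𝟙] there. *)
Lemma corresponds_natural :
  (forall (A A' B B' : C) (f : hom A A') (g : hom B B'),
     c A' B' ∘ (f ⊠ g) = (g ⊠ f) ∘ c A B) <->
  (forall (X X' A A' B B' : C) (f : hom X X') (g : hom A A') (h : hom B B'),
     s X' A' B' ∘ ((f ⊠ g) ⊠ h) = ((f ⊠ h) ⊠ g) ∘ s X A B).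
Proof.
have sE (X X' A A' B B' : C) (f : hom X X') (g : hom A A') (h : hom B B') :
    assoc X' B' A' ∘ (s X' A' B' ∘ ((f ⊠ g) ⊠ h))
    = (f ⊠ (c A' B' ∘ (g ⊠ h))) ∘ assoc X A B.
  rewrite (comp_reassoc (sc _ _ _)) -comp_assoc assoc_natural comp_assoc.
  by rewrite -tens_comp comp_id_l.
have sE' (X X' A A' B B' : C) (f : hom X X') (g : hom A A') (h : hom B B') :
    assoc X' B' A' ∘ (((f ⊠ h) ⊠ g) ∘ s X A B)
    = (f ⊠ ((h ⊠ g) ∘ c A B)) ∘ assoc X A B.
  rewrite (comp_reassoc (assoc_natural _ _ _)) -comp_assoc sc comp_assoc.
  by rewrite -tens_comp comp_id_r.
split=> [nat_c X X' A A' B B' f g h|nat_s A A' B B' f g].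
  by apply: (iso_monic (iso_assoc _ _ _)); rewrite sE sE' nat_c.
apply: unit_tens_inj; apply: (iso_epic (iso_assoc _ _ _)).
by rewrite -sE -sE' nat_s.
Qed.

(** By naturality, moving [A] past [B ⊗ D] in one step commutes with [c B D]; (B2), used for both
    orders of [B] and [D], splits that step in two. *)
Lemma corresponds_B1 X A B D :
    (forall (X X' A A' B B' : C) (f : hom X X') (g : hom A A') (h : hom B B'),
       s X' A' B' ∘ ((f ⊠ g) ⊠ h) = ((f ⊠ h) ⊠ g) ∘ s X A B) ->
    (forall X A B D : C, s X A (B ⊗ D) ∘ assoc (X ⊗ A) B D
       = (assoc X B D ⊠ ident A) ∘ s (X ⊗ B) A D ∘ (s X A B ⊠ ident D)) ->
  s (X ⊗ D) A B ∘ (s X A D ⊠ ident B) ∘ s (X ⊗ A) B D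
  = (s X B D ⊠ ident A) ∘ s (X ⊗ B) A D ∘ (s X A B ⊠ ident D).
Proof.
move=> nat_s B2.
have ia : is_iso (assoc X D B ⊠ ident A).
  by apply: iso_tens (iso_assoc _ _ _) (iso_ident _).
apply: (iso_monic ia); rewrite [in LHS]comp_assoc [in LHS]comp_assoc -B2.
rewrite -comp_assoc sc -tens_id (comp_reassoc (nat_s _ _ _ _ _ _ _ _ _)).
rewrite -!comp_assoc B2 -!comp_assoc.
rewrite (comp_reassoc (esym (tens_comp_r _ _ _))).
by rewrite -sc tens_comp_r -!comp_assoc.
Qed.

Lemma corresponds_invol :
  (forall A B, c B A ∘ c A B = \1) <-> (forall X A B, s X B A ∘ s X A B = \1).
Proof.
have ss X A B : assoc X A B ∘ (s X B A ∘ s X A B)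
                = (ident X ⊠ (c B A ∘ c A B)) ∘ assoc X A B.
  by rewrite (comp_reassoc (sc _ _ _)) -comp_assoc sc tens_comp_l comp_assoc.
split=> [cc X A B|s1 A B].
  apply: (iso_monic (iso_assoc _ _ _)).
  by rewrite ss cc tens_id comp_id_l comp_id_r.
apply: unit_tens_inj; apply: (iso_epic (iso_assoc _ _ _)).
by rewrite -ss s1 tens_id comp_id_l comp_id_r.
Qed.

End Correspondence.

(** * From skew braidings to braidings *)

Section SkewToUsual.
Context (C : monoidal_category) (s : skew_braiding C).

(** Agrees with the formula in [corresponds_left] by [skew_lunit_assoc]; here [lunit] acts on one
    factor only, as the triangle requires. *)
Definition unit_braid (A B : C) : hom (A ⊗ B) (B ⊗ A) :=
  (lunit B ⊠ ident A) ∘ s 𝟙 A B ∘ (lunit_inv A ⊠ ident B).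

Lemma unit_braidP : corresponds s unit_braid.
Proof.
move=> X A B; case: (runit_invP X) => r'r rr'.
(* Precomposing with this map inserts a unit between [X] and [A], so that (B4) applies with middle
   object [𝟙]. *)
have ir : is_iso ((runit_inv X ⊠ ident A) ⊠ ident B).
  apply: iso_tens (iso_ident _); apply: iso_tens (iso_ident _).
  by exists (runit X).
have clE : unit_braid A B ∘ (lunit A ⊠ ident B) = (lunit B ⊠ ident A) ∘ s 𝟙 A B.
  rewrite /unit_braid -!comp_assoc -tens_comp_r.
  by case: (lunit_invP A) => -> _; rewrite tens_id comp_id_r.
apply: (iso_epic ir); rewrite -!comp_assoc sbraid_natural -triangle.
rewrite -(triangle X A) !tens_comp_r -!comp_assoc.
rewrite (comp_reassoc (assoc_natural _ _ _)) -!comp_assoc.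
rewrite (comp_assoc _ (assoc X 𝟙 B ⊠ _)) -sbraid_B4 -!comp_assoc.
rewrite (comp_reassoc (esym (tens_comp_l _ _ _))) -clE tens_comp_l.
by rewrite (comp_reassoc (assoc_natural _ _ _)) -!comp_assoc.
Qed.

Lemma unit_braid_iso A B : is_iso (unit_braid A B).
Proof.
apply: iso_comp; last by apply: iso_tens (iso_lunit_inv _) (iso_ident _).
apply: iso_comp (sbraid_iso _ _ _ _).
by apply: iso_tens (iso_lunit _) (iso_ident _).
Qed.

Definition braiding_of_skew : braiding C :=
  @Braiding C unit_braid
    ((corresponds_natural unit_braidP).2 (sbraid_natural s))
    unit_braid_iso
    (fun A B D => unit_tens_inj
       ((B2_hexagon1 unit_braidP _ _ _ _).1 (sbraid_B2 s 𝟙 A B D)))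
    (fun A B D => unit_tens_inj
       ((B3_hexagon2 unit_braidP _ _ _ _).1 (sbraid_B3 s 𝟙 A B D))).

End SkewToUsual.

(** * From braidings to skew braidings *)

Section UsualToSkew.
Context (C : monoidal_category) (c : braiding C).

Definition conj_braid (X A B : C) : hom ((X ⊗ A) ⊗ B) ((X ⊗ B) ⊗ A) :=
  assoc_inv X B A ∘ (ident X ⊠ c A B) ∘ assoc X A B.

Lemma conj_braidP : corresponds conj_braid c.
Proof. by move=> X A B; rewrite !comp_assoc assocK comp_id_l. Qed.

Lemma conj_braid_iso X A B : is_iso (conj_braid X A B).
Proof.
apply: iso_comp (iso_assoc _ _ _); apply: iso_comp (iso_assoc_inv _ _ _) _.
exact: iso_tens (iso_ident _) (braid_iso _ _ _).
Qed.

Let conj_natural := (corresponds_natural conj_braidP).1 (braid_natural c).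

Let conj_B2 (X A B D : C) :=
  (B2_hexagon1 conj_braidP X A B D).2 (f_equal _ (braid_hexagon1 c A B D)).

Definition skew_of_braiding : skew_braiding C :=
  @SkewBraiding C conj_braid conj_natural conj_braid_iso
    (fun X A B D => corresponds_B1 conj_braidP X A B D conj_natural conj_B2)
    conj_B2
    (fun X A B D => (B3_hexagon2 conj_braidP X A B D).2
       (f_equal _ (braid_hexagon2 c A B D)))
    (corresponds_B4 conj_braidP).

End UsualToSkew.

(** * Equality of structures and the two bijections *)

Lemma skew_braiding_ext (C : skew_monoidal_category) (s t : skew_braiding C) :
  (forall X A B, s X A B = t X A B) -> s = t.
Proof.
case: s t => s s1 s2 s3 s4 s5 s6 [t t1 t2 t3 t4 t5 t6] /= st.
have {}st : s = t by do 3!apply: functional_extensionality_dep => ?.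
by subst t; f_equal; apply: proof_irrelevance.
Qed.

Lemma braiding_ext (C : monoidal_category) (c d : braiding C) :
  (forall A B, c A B = d A B) -> c = d.
Proof.
case: c d => c c1 c2 c3 c4 [d d1 d2 d3 d4] /= cd.
have {}cd : c = d by do 2!apply: functional_extensionality_dep => ?.
by subst d; f_equal; apply: proof_irrelevance.
Qed.

Lemma skew_symmetry_ext (C : skew_monoidal_category) (s t : skew_symmetry C) :
  skew_symmetry_braiding s = skew_symmetry_braiding t -> s = t.
Proof.
by case: s t => s s1 [t t1] /= st; subst t; f_equal; apply: proof_irrelevance.
Qed.

Lemma symmetry_ext (C : monoidal_category) (c d : symmetry C) :
  symmetry_braiding c = symmetry_braiding d -> c = d.
Proof.
by case: c d => c c1 [d d1] /= cd; subst d; f_equal; apply: proof_irrelevance.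
Qed.

Lemma braiding_of_skewK (C : monoidal_category) :
  cancel (@braiding_of_skew C) (@skew_of_braiding C).
Proof.
move=> s; apply: skew_braiding_ext => X A B.
exact/esym/(corresponds_right (unit_braidP s)).
Qed.

(** The recovered braiding and [c] both correspond to [skew_of_braiding c], which determines
    them. *)
Lemma skew_of_braidingK (C : monoidal_category) :
  cancel (@skew_of_braiding C) (@braiding_of_skew C).
Proof.
move=> c; apply: braiding_ext => A B.
rewrite (corresponds_left (conj_braidP c)).
exact: (corresponds_left (unit_braidP (skew_of_braiding c))).
Qed.

Definition symmetry_of_skew (C : monoidal_category) (s : skew_symmetry C) :
    symmetry C :=
  @Symmetry C (braiding_of_skew s)
    ((corresponds_invol (unit_braidP s)).2 (skew_symmetry_invol s)).

Definition skew_of_symmetry (C : monoidal_category) (c : symmetry C) :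
    skew_symmetry C :=
  @SkewSymmetry C (skew_of_braiding c)
    ((corresponds_invol (conj_braidP c)).1 (symmetry_invol c)).

Theorem proposition2p6 (C : monoidal_category) :
  exists F : skew_braiding C -> braiding C,
    [/\ bijective F,
        (forall (s : skew_braiding C) (X A B : C),
           assoc X B A ∘ s X A B = (ident X ⊠ F s A B) ∘ assoc X A B)
      & exists2 G : skew_symmetry C -> symmetry C,
          bijective G
          & forall s : skew_symmetry C,
              symmetry_braiding (G s) = F (skew_symmetry_braiding s)].
Proof.
exists (@braiding_of_skew C); split=> [||].
- exact: Bijective (@braiding_of_skewK C) (@skew_of_braidingK C).
- exact: unit_braidP.
(* Compatibility with [F] holds by construction, and both inverse laws reduce to the underlying
   braidings. *)
- exists (@symmetry_of_skew C) => //; exists (@skew_of_symmetry C) => s.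
  + exact/skew_symmetry_ext/braiding_of_skewK.
  + exact/symmetry_ext/skew_of_braidingK.
Qed.
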